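(* Let $p>0$ be a positive integer and let $a(z)=1+n_1z+\dots+n_{p-1}z^{p-1}+z^p\in\mathbb{Z}[z]$ be a monic palindromic polynomial of degree $p$, that is, $n_q=n_{p-q}$ for any $0<q<p$. Let $d$ be any positive integer. Then the triple $\alpha=(A_+,A_-,[d])$ of $1\times1$ matrices given by $A_\pm=N_0-N_\pm$, where $$N_0=\bigl[1+z^p\bigr],\qquad N_+=\Bigl[\sum_{q=1}^{p-1}[n_q]_+z^q\Bigr],\qquad N_-=\Bigl[\sum_{q=1}^{p-1}[-n_q]_+z^q\Bigr],$$ is a T-datum of size $1$. Furthermore, any T-datum of size $1$ is of this form.
   Context: Here $[x]_+=\max(0,x)$ for an integer $x$; $[1,r]=\{1,\dots,r\}$; $\mathfrak{S}_r$ is the group of permutations of $[1,r]$; $\delta$ is the Kronecker delta. For a square matrix $A$ with entries in $\mathbb{Z}[z^{\pm1}]$, $A^\dagger:=(A|_{z=z^{-1}})^{\mathsf T}$. T-datum: consider triples $(N_0,N_+,N_-)$ of matrices in $\mathrm{Mat}_{r\times r}(\mathbb{Z}[z])$, $N_\varepsilon=(\sum_{p\ge0}n^\varepsilon_{ab;p}z^p)_{a,b\in[1,r]}$, satisfying (N1) $n^0_{ab;p}=\delta_{ab}\delta_{p0}+\delta_{a\sigma(b)}\delta_{pp_a}$ for some $\sigma\in\mathfrak{S}_r$ and $p_a\in\mathbb{Z}_{>0}$; (N2) $n^\pm_{ab;p}\ge0$ for all $a,b,p$; (N3) $n^\pm_{ab;p}=0$ unless $0<p<p_a$; (N4) $n^+_{ab;p}n^-_{ab;p}=0$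 for all $a,b,p$. A T-datum of size $r$ is a triple $(A_+,A_-,D)$ such that $A_\pm=N_0-N_\pm$ for some $(N_0,N_+,N_-)$ satisfying (N1)-(N4) and $D$ is a positive integer diagonal matrix with $N_0D=DN_0$, $D^{-1}N_\pm D\in\mathrm{Mat}_{r\times r}(\mathbb{Z}[z])$, and $A_+DA_-^\dagger=A_-DA_+^\dagger$. *)

(* Defs.v *)
From mathcomp Require Import all_boot all_order all_fingroup all_algebra.

Set Implicit Arguments.
Unset Strict Implicit.
Unset Printing Implicit Defensive.

Import Order.TTheory GRing.Theory Num.Theory.
Local Open Scope ring_scope.

(* The ring Z[z^{+-1}] is viewed inside its fraction field Q(z).  The
   substitution z = z^{-1}, the inverse of D and the identity
   A_+ D A_-^dagger = A_- D A_+^dagger are taken there. *)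
Notation ratfun := {fraction {poly int}}.

Definition lift_mx (r : nat) (A : 'M[{poly int}]_r) : 'M[ratfun]_r :=
  map_mx (@tofrac {poly int}) A.

Definition lift_int_mx (r : nat) (D : 'M[int]_r) : 'M[ratfun]_r :=
  map_mx (intr : int -> ratfun) D.

Definition subst_zinv (q : {poly int}) : ratfun :=
  (map_poly (intr : int -> ratfun) q).[(tofrac 'X)^-1].

(* Only needed for matrices over Z[z]; the result has entries in Z[z^{-1}]. *)
Definition dagger (r : nat) (A : 'M[{poly int}]_r) : 'M[ratfun]_r :=
  (map_mx subst_zinv A)^T.

Definition pos_part (x : int) : int := Num.max 0 x.

(* s is the permutation sigma and P a is the integer p_a. *)
Definition N1 (r : nat) (N0 : 'M[{poly int}]_r) (s : 'S_r) (P : 'I_r -> nat) :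
    Prop :=
  (forall a, (0 < P a)%N) /\
  forall (a b : 'I_r) (p : nat),
    (N0 a b)`_p = (a == b)%:R * (p == 0%N)%:R + (a == s b)%:R * (p == P a)%:R.

Definition N2 (r : nat) (N : 'M[{poly int}]_r) : Prop :=
  forall (a b : 'I_r) (p : nat), 0 <= (N a b)`_p.

Definition N3 (r : nat) (N : 'M[{poly int}]_r) (P : 'I_r -> nat) : Prop :=
  forall (a b : 'I_r) (p : nat), ~~ (0 < p < P a)%N -> (N a b)`_p = 0.

Definition N4 (r : nat) (Np Nm : 'M[{poly int}]_r) : Prop :=
  forall (a b : 'I_r) (p : nat), (Np a b)`_p * (Nm a b)`_p = 0.

Definition Ncond (r : nat) (N0 Np Nm : 'M[{poly int}]_r) : Prop :=
  exists (s : 'S_r) (P : 'I_r -> nat),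
    [/\ N1 N0 s P, N2 Np /\ N2 Nm, N3 Np P /\ N3 Nm P & N4 Np Nm].

Definition pos_diag (r : nat) (D : 'M[int]_r) : Prop :=
  is_diag_mx D /\ forall i, 0 < D i i.

Definition conj_integral (r : nat) (D : 'M[int]_r) (N : 'M[{poly int}]_r) :
    Prop :=
  exists M : 'M[{poly int}]_r,
    invmx (lift_int_mx D) *m lift_mx N *m lift_int_mx D = lift_mx M.

Definition Tdatum (r : nat) (Ap Am : 'M[{poly int}]_r) (D : 'M[int]_r) : Prop :=
  exists N0 Np Nm : 'M[{poly int}]_r,
    [/\ Ncond N0 Np Nm /\ (Ap = N0 - Np /\ Am = N0 - Nm),
        pos_diag D,
        N0 *m map_mx polyC D = map_mx polyC D *m N0,
        conj_integral D Np /\ conj_integral D Nm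
      & lift_mx Ap *m lift_int_mx D *m dagger Am
        = lift_mx Am *m lift_int_mx D *m dagger Ap].

Definition monic_palindromic (p : nat) (a : {poly int}) : Prop :=
  a = 1 + \sum_(1 <= q < p) a`_q *: 'X^q + 'X^p /\
  forall q : nat, (0 < q < p)%N -> a`_q = a`_(p - q).

Definition N0_of (p : nat) : 'M[{poly int}]_1 := (1 + 'X^p)%:M.

Definition Np_of (p : nat) (a : {poly int}) : 'M[{poly int}]_1 :=
  (\sum_(1 <= q < p) pos_part a`_q *: 'X^q)%:M.

Definition Nm_of (p : nat) (a : {poly int}) : 'M[{poly int}]_1 :=
  (\sum_(1 <= q < p) pos_part (- a`_q) *: 'X^q)%:M.

(* Main.v *)
(* For size 1 put f = A_+, g = A_-, and let f^*, g^* be their reciprocals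
   z^p f(1/z), z^p g(1/z).  The symmetry condition reads f g^* = g f^*, i.e.
   f (g^* - g) = g (f^* - f).  As f(0) = g(0) = 1, comparing coefficients of z^k
   gives g^*_k - g_k = f^*_k - f_k as soon as both differences vanish below k;
   so N_+ - N_- has equal coefficients at k and p - k, and since N_+ and N_-
   have disjoint supports and nonnegative coefficients, they are recovered from
   the signs of N_+ - N_- and the induction proceeds. *)
Require Import Defs.
From mathcomp Require Import all_boot all_order all_fingroup all_algebra.
From mathcomp Require Import zify.

Import Order.TTheory GRing.Theory Num.Theory.
Local Open Scope ring_scope.

(** The order of the reversal is the parameter [p], not the degree of [q], so the same power of z
    clears denominators on both sides of the symmetry condition. *)
Definition reciprocal (p : nat) (q : {poly int}) : {poly int} :=
  \poly_(i < p.+1) q`_(p - i).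

Lemma tofracC (c : int) : tofrac c%:P = c%:~R :> ratfun.
Proof. by rewrite -{1}(intz c) !rmorph_int. Qed.

Lemma intr_ratfun_eq0 (c : int) : (c%:~R == 0 :> ratfun) = (c == 0).
Proof. by rewrite -tofracC tofrac_eq0 polyC_eq0. Qed.

Lemma tofracX_neq0 : tofrac 'X != 0 :> ratfun.
Proof. by rewrite tofrac_eq0 polyX_eq0. Qed.

Lemma subst_zinvE (p : nat) (q : {poly int}) : (size q <= p.+1)%N ->
  subst_zinv q = tofrac (reciprocal p q) / tofrac 'X ^+ p.
Proof.
(* Padding the expansion to exactly [p.+1] terms makes the index reversal i -> p - i available. *)
move=> szq; rewrite /subst_zinv (@horner_coef_wide _ p.+1); last first.
  exact: leq_trans (size_poly _ _) szq.
rewrite /reciprocal poly_def rmorph_sum mulr_suml.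
rewrite (reindex_inj rev_ord_inj); apply: eq_bigr => i _ /=.
rewrite coef_map_id0 ?rmorph0 // subSS -mul_polyC tofracM tofracC tofracXn.
rewrite -mulrA; congr (_ * _).
have le_ip : (i <= p)%N by rewrite -ltnS.
have -> : tofrac 'X ^+ p = tofrac 'X ^+ i * tofrac 'X ^+ (p - i) :> ratfun.
  by rewrite -exprD subnKC.
rewrite exprVn invfM mulVKf //.
by rewrite expf_eq0 (negPf tofracX_neq0) andbF.
Qed.

(** Both sides carry the nonzero factor c / z^p. Once it is cancelled, injectivity of [tofrac]
    brings the identity down to Z[z]. *)
Lemma cross_reciprocal (p : nat) (c : int) (f g : {poly int}) :
    c != 0 -> (size f <= p.+1)%N -> (size g <= p.+1)%N ->
  tofrac f * c%:~R * subst_zinv g = tofrac g * c%:~R * subst_zinv f <->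
  f * reciprocal p g = g * reciprocal p f.
Proof.
move=> c0 szf szg; rewrite !(@subst_zinvE p) // !mulrA.
have Xp0 : (tofrac 'X ^+ p)^-1 != 0 :> ratfun.
  by rewrite invr_eq0 expf_eq0 (negPf tofracX_neq0) andbF.
have c0' : c%:~R != 0 :> ratfun by rewrite intr_ratfun_eq0.
rewrite ![_ * c%:~R * _]mulrAC -!tofracM.
split=> [/(mulIf c0')/(mulIf Xp0)/eqP|->] //.
by rewrite tofrac_eq => /eqP.
Qed.

(** As [u] and [v] vanish below [k], only the constant terms of [f] and [g] contribute in degree
    [k], and these are 1. *)
Lemma cross_coef (k : nat) (f g u v : {poly int}) :
    f`_0 = 1 -> g`_0 = 1 -> f * v = g * u ->
    (forall j, (j < k)%N -> u`_j = 0 /\ v`_j = 0) ->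
  u`_k = v`_k.
Proof.
move=> f0 g0 /(congr1 (fun q : {poly int} => q`_k)) eqk low.
have head (h w : {poly int}) : h`_0 = 1 ->
    (forall j, (j < k)%N -> w`_j = 0) -> (h * w)`_k = w`_k.
  move=> h0 w0; rewrite coefM big_ord_recl /= h0 mul1r subn0 big1 ?addr0 //.
  by case=> i /= ik _; rewrite /bump w0 ?mulr0 //; lia.
by rewrite !head // in eqk => j /low [].
Qed.

Lemma cross_palindromic (p : nat) (P M : {poly int}) :
    (forall q, ~~ (0 < q < p)%N -> P`_q = 0) ->
    (forall q, ~~ (0 < q < p)%N -> M`_q = 0) ->
    (forall q, 0 <= P`_q) -> (forall q, 0 <= M`_q) ->
    (forall q, P`_q * M`_q = 0) -> (0 < p)%N ->
    (1 + 'X^p - P) * reciprocal p (1 + 'X^p - M) =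
    (1 + 'X^p - M) * reciprocal p (1 + 'X^p - P) ->
  forall k, (k <= p)%N -> P`_k = P`_(p - k) /\ M`_k = M`_(p - k).
Proof.
move=> suppP suppM geP geM disj p0 eqfg.
set f := 1 + 'X^p - P in eqfg; set g := 1 + 'X^p - M in eqfg.
have coef0 (N : {poly int}) : (forall q, ~~ (0 < q < p)%N -> N`_q = 0) ->
    (1 + 'X^p - N)`_0 = 1.
  by move=> suppN; rewrite !coefE suppN // (ltn_eqF p0) subr0 addr0.
(* Reversal swaps the terms 1 and z^p, so they cancel in the difference and only [N] is left. *)
have diff (N : {poly int}) k : (k <= p)%N ->
    (reciprocal p (1 + 'X^p - N) - (1 + 'X^p - N))`_k = N`_k - N`_(p - k).
  move=> kp; rewrite !coefE ltnS kp.
  have -> : (p - k == 0)%N = (k == p) by lia.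
  have -> : (p - k == p)%N = (k == 0)%N by lia.
  by rewrite [(k == p)%:R + _]addrC opprB [LHS]addrC addrA subrK.
have eqd : f * (reciprocal p g - g) = g * (reciprocal p f - f).
  by rewrite mulrBr [RHS]mulrBr eqfg [f * g]mulrC.
elim/ltn_ind=> k IHk kp.
have := cross_coef k f g _ _ (coef0 _ suppP) (coef0 _ suppM) eqd.
rewrite !diff // => eqk.
(* The induction hypothesis makes both differences vanish below [k], as [cross_coef] requires. *)
have {}eqk : P`_k - P`_(p - k) = M`_k - M`_(p - k).
  apply: eqk => j jk; rewrite !diff ?(leq_trans (ltnW jk)) //.
  by have [|<- <-] := IHk j jk; rewrite ?(leq_trans (ltnW jk)) // !subrr.
have := disj k; have := disj (p - k)%N.
have := geP k; have := geP (p - k)%N; have := geM k; have := geM (p - k)%N.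
by move: eqk; nia.
Qed.

Lemma coef_sum_scaleXn (p : nat) (c : nat -> int) (k : nat) :
  (\sum_(1 <= q < p) c q *: 'X^q)`_k = if (0 < k < p)%N then c k else 0.
Proof.
rewrite coef_sum; case: ifP => kp.
  rewrite (bigD1_seq k) ?mem_index_iota ?iota_uniq //= !coefE eqxx mulr1.
  by rewrite big1 ?addr0 // => q qk; rewrite !coefE eq_sym (negPf qk) mulr0.
rewrite big_seq big1 // => q; rewrite mem_index_iota => qp.
rewrite !coefE; case: eqP => [kq|]; last by rewrite mulr0.
by rewrite kq qp in kp.
Qed.

Lemma size_sub_supp (p : nat) (N : {poly int}) :
  (0 < p)%N -> (forall q, ~~ (0 < q < p)%N -> N`_q = 0) ->
  (size (1 + 'X^p - N)%R <= p.+1)%N.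
Proof.
move=> p0 suppN; apply/leq_sizeP => j pj; rewrite !coefE suppN; last by lia.
have -> : (j == 0)%N = false by lia.
by have -> : (j == p)%N = false by lia.
Qed.

Lemma mx11_eqP (R : Type) (A B : 'M[R]_1) : A = B <-> A 0 0 = B 0 0.
Proof. by split=> [->|eqAB] //; apply/matrixP => i j; rewrite !ord1. Qed.

Lemma Tdatum_mx11_cross (f g : 'M[{poly int}]_1) (D : 'M[int]_1) :
  lift_mx f *m lift_int_mx D *m dagger g =
  lift_mx g *m lift_int_mx D *m dagger f <->
  tofrac (f 0 0) * (D 0 0)%:~R * subst_zinv (g 0 0) =
  tofrac (g 0 0) * (D 0 0)%:~R * subst_zinv (f 0 0).
Proof.
by rewrite mx11_eqP !mxE !big_ord1 !mxE !big_ord1 !mxE.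
Qed.

(** Matrices of size 1 commute, so conjugation by [D] fixes [N], which is its own integral
    witness. *)
Lemma conj_integral_mx11 (D : 'M[int]_1) (N : 'M[{poly int}]_1) :
  D 0 0 != 0 -> conj_integral D N.
Proof.
move=> D0; exists N.
rewrite -mulmxA [lift_mx N *m _]comm_mx_sym ?mulKmx //.
  by rewrite unitmxE det_mx11 mxE unitfE intr_ratfun_eq0.
by rewrite /comm_mx mx11_eqP !mxE !big_ord1 mulrC.
Qed.

(** The reversal of order [p] fixes 1 + z^p. In the direct implication this turns the symmetry
    condition into commutativity of a product. *)
Lemma reciprocal_palindromic (p : nat) (N : {poly int}) :
    (forall k, (k <= p)%N -> N`_k = N`_(p - k)) ->
    (0 < p)%N -> (forall q, ~~ (0 < q < p)%N -> N`_q = 0) ->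
  reciprocal p (1 + 'X^p - N) = 1 + 'X^p - N.
Proof.
move=> palN p0 suppN; apply/polyP => k; rewrite coef_poly ltnS.
case: leqP => kp; last first.
  by rewrite nth_default // (leq_trans (size_sub_supp _ _ p0 suppN)).
rewrite !coefE -palN //.
have -> : (p - k == 0)%N = (k == p) by lia.
have -> : (p - k == p)%N = (k == 0)%N by lia.
by rewrite [(k == p)%:R + _]addrC.
Qed.

Theorem theorem4p1 :
  (forall (p : nat) (a : {poly int}) (d : int),
     (0 < p)%N -> monic_palindromic p a -> 0 < d ->
     Tdatum (N0_of p - Np_of p a) (N0_of p - Nm_of p a) (d%:M : 'M[int]_1))
  /\
  (forall (Ap Am : 'M[{poly int}]_1) (D : 'M[int]_1),
     Tdatum Ap Am D ->
     exists (p : nat) (a : {poly int}) (d : int),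
       [/\ (0 < p)%N, monic_palindromic p a, 0 < d,
           Ap = N0_of p - Np_of p a /\ Am = N0_of p - Nm_of p a
         & D = d%:M]).
Proof.
split=> [p a d p0 [_ pal] d0 | Ap Am D].
  exists (N0_of p), (Np_of p a), (Nm_of p a).
  have dM : (d%:M : 'M[int]_1) 0 0 = d by rewrite mxE eqxx.
  have supp (c : nat -> int) q : ~~ (0 < q < p)%N -> (\sum_(1 <= q < p) c q *: 'X^q)`_q = 0.
    by move=> /negPf qp; rewrite coef_sum_scaleXn qp.
  (* Any coefficientwise map preserves the palindromic symmetry; [h] will be x -> [x]_+ and x ->
     [-x]_+. *)
  have palc (h : int -> int) k : (k <= p)%N ->
      (\sum_(1 <= q < p) h a`_q *: 'X^q)`_k
      = (\sum_(1 <= q < p) h a`_q *: 'X^q)`_(p - k).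
    move=> kp; rewrite !coef_sum_scaleXn.
    have -> : (0 < p - k < p)%N = (0 < k < p)%N by lia.
    by case: ifP => // /pal ->.
  split.
  - split=> //; exists 1%g, (fun=> p); split.
    + split=> // i j q; rewrite !ord1 mxE eqxx !mulr1n !mul1r.
      by rewrite !coefE.
    + by split=> i j q; rewrite !ord1 mxE eqxx mulr1n coef_sum_scaleXn;
        case: ifP => // _; rewrite le_max lexx.
    + by split=> i j q qp; rewrite !ord1 mxE eqxx mulr1n supp.
    + move=> i j q; rewrite !ord1 !mxE eqxx !mulr1n !coef_sum_scaleXn.
      by case: ifP => // _; rewrite /pos_part; nia.
  - split; first exact: scalar_mx_is_diag.
    by move=> i; rewrite ord1 dM.
  - by apply/mx11_eqP; rewrite !mxE !big_ord1 mulrC.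
  - by split; apply: conj_integral_mx11; rewrite dM gt_eqF.
  - apply/Tdatum_mx11_cross; rewrite dM !mxE eqxx !mulr1n.
    apply/(@cross_reciprocal p); rewrite ?gt_eqF ?size_sub_supp //;
      try by move=> q; apply: supp.
    rewrite !reciprocal_palindromic //; first by rewrite mulrC.
    + exact: (palc pos_part).
    + by move=> q; apply: supp.
    + exact: (palc (pos_part \o -%R)).
    + by move=> q; apply: supp.
case=> N0 [Np] [Nm] [[Ncd [-> ->]] [/is_diag_mxP _ D0] _ _].
move/Tdatum_mx11_cross => cross.
have {Ncd} [s [P [[P0 N0E] [Np0 Nm0] [suppNp suppNm] disj]]] := Ncd.
(* On a single index sigma is trivial, so (N1) leaves one free parameter, the exponent p_a. *)
have N0p : N0 0 0 = 1 + 'X^(P 0).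
  by apply/polyP => q; rewrite N0E !ord1 eqxx !mul1r !coefE.
move: (P 0) (P0 0) (suppNp 0 0) (suppNm 0 0) N0p => p p0 suppP suppM N0p.
move: cross; rewrite !mxE N0p.
move/(cross_reciprocal _ _ _ _ (lt0r_neq0 (D0 0)) (size_sub_supp _ _ p0 suppP)
        (size_sub_supp _ _ p0 suppM)).
move/(cross_palindromic _ _ _ suppP suppM (Np0 0 0) (Nm0 0 0) (disj 0 0) p0).
move=> pal.
(* The middle coefficients must be N_+ - N_-, with sign opposite to that in A_+, for their positive
   parts to give back N_+. *)
pose a : {poly int} := 1 + (Np 0 0 - Nm 0 0) + 'X^p.
have aE q : (0 < q < p)%N -> a`_q = (Np 0 0)`_q - (Nm 0 0)`_q.
  case/andP=> q0 qp; rewrite !coefE.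
  by rewrite (gtn_eqF q0) (ltn_eqF qp) add0r addr0.
have NE (N : 'M[{poly int}]_1) c :
    (forall q, ~~ (0 < q < p)%N -> (N 0 0)`_q = 0) ->
    (forall q, (0 < q < p)%N -> (N 0 0)`_q = c q) ->
    N = (\sum_(1 <= q < p) c q *: 'X^q)%:M.
  move=> suppN Nc; apply/mx11_eqP; rewrite [RHS]mxE eqxx mulr1n.
  apply/polyP => q; rewrite coef_sum_scaleXn.
  by case: ifP => [/Nc|/negbT/suppN].
exists p, a, (D 0 0); split=> //; last by apply/mx11_eqP; rewrite mxE eqxx mulr1n.
  split=> [|q qp].
    congr (1 + _ + _); apply/polyP => q; rewrite coef_sum_scaleXn.
    case: ifP => [/aE -> | /negbT qp]; first by rewrite coefB.
    by rewrite coefB suppP ?suppM.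
  have [|Pq Mq] := pal q; first by lia.
  by rewrite !aE ?Pq ?Mq //; lia.
have -> : N0 = N0_of p by apply/mx11_eqP; rewrite N0p mxE eqxx mulr1n.
(* If x, y >= 0 and xy = 0, then [x - y]_+ = x and [y - x]_+ = y. *)
split; congr (_ - _); apply: NE => // q qp; rewrite aE // /pos_part;
  have := disj 0 0 q; have := Np0 0 0 q; have := Nm0 0 0 q; nia.
Qed.
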